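(* Let $\mathcal{M}_\Omega$ be a nonparametric missing data model with description $\Omega$, partially observed variables $\mathbf{X}$, proxy variables $\mathbf{X}^\ast$ and response indicators $\mathbf{R}$. A conditionally complete imputation method $\xi_{\Omega, p(\mathbf{X}^\ast,\mathbf{R})}$ exists if and only if the full law $p(\mathbf{X},\mathbf{R})$ is identifiable from $(\Omega, p(\mathbf{X}^\ast,\mathbf{R}))$.
   Context: Variables and missing data model. $\mathbf{X}$ is a finite set of random variables that may be missing. Each $X\in\mathbf{X}$ has a binary response indicator $R_X\in\{0,1\}$ and a proxy variable $X^\ast$ with $X^\ast = X$ if $R_X=1$ and $X^\ast=\mathrm{NA}$ (missing) if $R_X=0$. $\mathbf{R}$ and $\mathbf{X}^\ast$ are the sets of all response indicators and all proxies. It is assumed that there are no additional fully observed variables. For $\mathbf{Y}\subseteq\mathbf{X}$, $R_{\mathbf{Y}}=1$ means $R_Y=1$ for all $Y\in\mathbf{Y}$, and $R_{\mathbf{Y}}=0$ means $R_Y=0$ for all $Y\in\mathbf{Y}$. A missing data model is a set of joint distributions of $(\mathbf{X},\mathbf{X}^\ast,\mathbf{R})$; each factorizes as $p(\mathbf{X}^\ast\mid\mathbf{X},\mathbf{R})\,p(\mathbf{X},\mathbf{R})$, where the first factor is the deterministic relation defining the proxies. Here $p$ denotes probability mass/density functions. The full law is $p(\mathbf{X},\mathbf{R})$, the target law is $p(\mathbf{X})$, and the observed data law is $p(\mathbf{X}^\ast,\mathbf{R})$. A nonparametric missing data model $\mathcal{M}_\Omega$ is a missing data model whose members share a description $\Omega$,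 i.e. a set of nonparametric assumptions (for example conditional independence restrictions, possibly encoded by a directed acyclic graph). Standing assumption (positivity): for every member, $p(\mathbf{X}=\mathbf{x},\mathbf{R}=\mathbf{r})>0$ for all value assignments $(\mathbf{x},\mathbf{r})$. Identifiability. A query $Q$ is identifiable from $(\Omega,p(\mathbf{X}^\ast,\mathbf{R}))$ if there exists a functional $f$ such that $Q=f(p(\mathbf{X}^\ast,\mathbf{R}))$ for every element of $\mathcal{M}_\Omega$. Imputation method. For a missingness pattern $\mathbf{r}\in\{0,1\}^{|\mathbf{X}|}$ (a value of $\mathbf{R}$), $\mathbf{X}$ is partitioned into the observed variables $\mathbf{X}_1$ (those with indicator $1$ under $\mathbf{r}$) and the missing variables $\mathbf{X}_0$ (those with indicator $0$ under $\mathbf{r}$). An imputation method is a collection of stochastic kernels $\xi_{\Omega,p(\mathbf{X}^\ast,\mathbf{R})}=\{\xi_{\mathbf{r}}(\mathbf{x}_0\mid\mathbf{x}_1):\mathbf{r}\in\{0,1\}^{|\mathbf{X}|}\}$, where $\xi_{\mathbf{r}}(\mathbf{x}_0\mid\mathbf{x}_1)$ is a conditional distribution over $\mathbf{X}_0$ given $\mathbf{X}_1=\mathbf{x}_1$ whose form is determined only by $\Omega$ and the observed data law $p(\mathbf{X}^\ast,\mathbf{R})$ (so the same functional of the observed data law is used for all members of $\mathcal{M}_\Omega$). Conditionally complete. An imputation method is conditionally complete if for every missingness pattern $\mathbf{r}$, with corresponding partition $(\mathbf{X}_0,\mathbf{X}_1)$, $\xi_{\mathbf{r}}(\mathbf{x}_0\mid\mathbf{x}_1)=p(\mathbf{X}_0=\mathbf{x}_0\mid\mathbf{X}_1=\mathbf{x}_1,R_{\mathbf{X}_1}=1,R_{\mathbf{X}_0}=0)$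 for all value assignments $(\mathbf{x}_0,\mathbf{x}_1)$ (for every member of $\mathcal{M}_\Omega$). *)

(* Defs.v *)
From HB Require Import structures.
From mathcomp Require Import all_boot all_order all_algebra.
From mathcomp Require Import all_classical all_reals all_analysis.
From mathcomp Require Import measurable_realfun.
Import Order.TTheory GRing.Theory Num.Theory.

Set Implicit Arguments.
Unset Strict Implicit.
Unset Printing Implicit Defensive.

Local Open Scope classical_set_scope.
Local Open Scope ring_scope.

Definition cylinders (I : Type) (d : I -> measure_display)
    (T : forall i, measurableType (d i)) : set (set (forall i, T i)) :=
  [set C | exists (i : I) (B : set (T i)),
     measurable B /\ C = (fun x : forall i, T i => x i) @^-1` B].
Arguments cylinders {I d} T _.

Definition prod_space (I : Type) (d : I -> measure_display)
    (T : forall i, measurableType (d i)) :=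
  g_sigma_algebraType (cylinders T).

HB.instance Definition _ (I : Type) (d : I -> measure_display)
    (T : forall i, measurableType (d i)) := Measurable.on (prod_space T).

Section prod_measure.
Local Open Scope ereal_scope.
Context (R : realType) (I : finType) (d : I -> measure_display)
  (T : forall i, measurableType (d i))
  (mu : forall i, {sigma_finite_measure set (T i) -> \bar R}).

Definition set_coord (x : prod_space T) (i : I) (t : T i) : prod_space T :=
  @eqtype.dfwith I (fun j => T j) x i t.

Definition integrate_coord (i : I) (f : prod_space T -> \bar R) :
    prod_space T -> \bar R :=
  fun x => \int[mu i]_t f (set_coord x t).

Definition iterated_integral (s : seq I) (f : prod_space T -> \bar R) :=
  foldr integrate_coord f s.

(* The product of the [mu i]: all coordinates of the indicator function are
   integrated out, so that the value at the base point is immaterial. *)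
Definition prod_measure (A : set (prod_space T)) : \bar R :=
  iterated_integral (enum I) (fun x => (\1_A x)%:E) point.

Lemma measurable_set_coord (i : I) :
  measurable_fun [set: prod_space T * T i]
    (fun z => set_coord z.1 z.2).
Proof.
have mE : @measurable _ (prod_space T) = <<s cylinders T >> by [].
apply: (measurability _ mE).
move=> _ [_ [j [B [mB ->]]] <-].
rewrite setTI.
have [ij|ij] := eqVneq i j.
  case: _ / ij B mB => B mB.
  rewrite (_ : _ @^-1` _ = snd @^-1` B).
    by rewrite -[X in measurable X]setTI; exact: measurable_snd.
  by apply/seteqP; split=> z /=; rewrite /set_coord dfwith_in.
rewrite (_ : _ @^-1` _ = fst @^-1` ((fun x : prod_space T => x j) @^-1` B)).
  rewrite -[X in measurable X]setTI; apply: measurable_fst => //.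
  by apply: sub_sigma_algebra; exists j, B.
by apply/seteqP; split=> z /=; rewrite /set_coord dfwith_out.
Qed.

Let nonneg (f : prod_space T -> \bar R) := forall x, 0 <= f x.

Lemma integrate_coord_ge0 i f : nonneg f -> nonneg (integrate_coord i f).
Proof. by move=> f0 x; apply: integral_ge0. Qed.

Lemma measurable_integrate_coord i f : nonneg f ->
  measurable_fun [set: prod_space T] f -> measurable_fun setT (integrate_coord i f).
Proof.
move=> f0 mf.
apply: (@measurable_fun_fubini_tonelli_F _ _ _ _ R (mu i)
          (fun z : prod_space T * T i => f (set_coord z.1 z.2))) => //.
exact: (measurableT_comp mf (@measurable_set_coord i)).
Qed.

Lemma iterated_integral_ge0 s f : nonneg f -> nonneg (iterated_integral s f).
Proof. by move=> f0; elim: s => //= i s; exact: integrate_coord_ge0. Qed.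

Lemma measurable_iterated_integral s f : nonneg f ->
  measurable_fun [set: prod_space T] f -> measurable_fun setT (iterated_integral s f).
Proof.
move=> f0 mf; elim: s => //= i s; apply: measurable_integrate_coord.
exact: iterated_integral_ge0.
Qed.

Lemma iterated_integral_nneseries s (f : nat -> prod_space T -> \bar R) :
  (forall n, nonneg (f n)) -> (forall n, measurable_fun [set: prod_space T] (f n)) ->
  iterated_integral s (fun x => \sum_(n <oo) f n x) =
  (fun x => \sum_(n <oo) iterated_integral s (f n) x).
Proof.
move=> f0 mf; elim: s => //= i s ->; apply/funext => x.
rewrite /integrate_coord integral_nneseries//.
  move=> n.
  have mg : measurable_fun [set: T i] (fun t => (x, t) : prod_space T * T i).
    exact: measurable_pair1.
  apply: (measurableT_comp (measurable_iterated_integral s (f0 n) (mf n))).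
  exact: (measurableT_comp (@measurable_set_coord i) mg).
by move=> n t _; exact: iterated_integral_ge0.
Qed.

Let prod_measure0 : prod_measure set0 = 0.
Proof.
rewrite /prod_measure.
suff H s : iterated_integral s (fun x => (\1_(@set0 (prod_space T)) x)%:E)
   = cst 0 by rewrite H.
elim: s => [|i s /= ->]; first by apply/funext => x /=; rewrite indicE in_set0.
by apply/funext => x; rewrite /integrate_coord integral0.
Qed.

Let prod_measure_ge0 A : 0 <= prod_measure A.
Proof. by apply: iterated_integral_ge0 => x; rewrite lee_fin. Qed.

Let prod_measure_sigma_additive : semi_sigma_additive prod_measure.
Proof.
move=> F mF tF mUF.
rewrite [X in _ --> X](_ : _ = \sum_(n <oo) prod_measure (F n)).
  by apply: is_cvg_nneseries => n _ _; exact: prod_measure_ge0.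
rewrite /prod_measure.
have -> : (fun x : prod_space T => (\1_(\bigcup_n F n) x)%:E : \bar R) =
    fun x => \sum_(n <oo) (\1_(F n) x)%:E.
  apply/funext => x; have := @measure_semi_bigcup _ _ _
    (\d_x : {measure set (prod_space T) -> \bar R}) F mF tF mUF.
  by rewrite /dirac.
rewrite iterated_integral_nneseries//.
  by move=> n x; rewrite lee_fin.
by move=> n; apply/measurable_EFinP; exact: measurable_indic.
Qed.

HB.instance Definition _ := isMeasure.Build _ _ _ prod_measure
  prod_measure0 prod_measure_ge0 prod_measure_sigma_additive.

End prod_measure.

Section prod_measure_box.
Local Open Scope ereal_scope.
Context (R : realType) (I : finType) (d : I -> measure_display)
  (T : forall i, measurableType (d i))
  (mu : forall i, {sigma_finite_measure set (T i) -> \bar R}).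

Lemma prod_measure_box (B : forall i, set (T i)) :
  (forall i, measurable (B i)) ->
  prod_measure mu [set x : prod_space T | forall i, B i (x i)] =
  \prod_(i : I) mu i (B i).
Proof.
move=> mB; rewrite /prod_measure.
have H (s : seq I) : uniq s -> forall x : prod_space T,
    iterated_integral mu s
      (fun x => (\1_[set x : prod_space T | forall i, B i (x i)] x)%:E) x =
    (\prod_(i <- s) mu i (B i)) *
      (\1_[set x : prod_space T | forall i, i \notin s -> B i (x i)] x)%:E.
  elim: s => [_ x|i s IH /= /andP[nis us] x].
    by rewrite big_nil mul1e /= !indicE; congr ((_ : bool)%:R%:E);
      apply/idP/idP; rewrite !inE /= => h j; [move=> _|]; exact: h.
  rewrite /integrate_coord big_cons.
  have -> : (fun t : T i => iterated_integral mu s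
      (fun x => (\1_[set x : prod_space T | forall i, B i (x i)] x)%:E)
        (set_coord x t)) = (fun t : T i => (\prod_(i <- s) mu i (B i) *
        (\1_[set x : prod_space T | forall j, j \notin i :: s -> B j (x j)]
           x)%:E) * (\1_(B i) t)%:E).
    apply/funext => t; rewrite IH// -muleA; congr (_ * _).
    rewrite -EFinM !indicE -natrM mulnb; congr ((_ : bool)%:R%:E).
    apply/idP/andP; rewrite !inE /=.
      move=> h; split; last by have := h i nis; rewrite /set_coord eqtype.dfwith_in.
      move=> j; rewrite inE negb_or => /andP[ji js].
      by have := h j js; rewrite /set_coord eqtype.dfwith_out// eq_sym.
    move=> [h1 h2] j js; have [ij|ij] := eqVneq i j.
      by case: _ / ij js => _; rewrite /set_coord eqtype.dfwith_in.
    rewrite /set_coord eqtype.dfwith_out//; apply: h1.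
    by rewrite inE negb_or eq_sym ij.
  rewrite ge0_integralZl//.
  - by rewrite integral_indic// setIT [LHS]muleC muleA.
  - by apply/measurable_EFinP; exact: measurable_indic.
  - by rewrite mule_ge0 ?prode_ge0 ?lee_fin.
rewrite H ?enum_uniq// indicE mem_set ?mule1 -?big_enum//.
by move=> i /=; rewrite mem_enum.
Qed.

End prod_measure_box.

(* [None] is the missing value NA. *)

Definition option_display : measure_display -> measure_display.
Proof. exact. Qed.

Section measurable_option.
Context d (T : measurableType d).

Definition option_measurable : set (set (option T)) :=
  [set A | measurable (Some @^-1` A)].

Let option_set0 : option_measurable set0.
Proof. by rewrite /option_measurable /= preimage_set0. Qed.

Let option_setC A : option_measurable A -> option_measurable (~` A).
Proof. by rewrite /option_measurable /= preimage_setC; exact: measurableC. Qed.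

Let option_bigcup (F : (set (option T))^nat) :
  (forall i, option_measurable (F i)) -> option_measurable (\bigcup_i (F i)).
Proof.
by rewrite /option_measurable /= preimage_bigcup => mF; exact: bigcupT_measurable.
Qed.

HB.instance Definition _ := @isMeasurable.Build (option_display d) (option T)
  option_measurable option_set0 option_setC option_bigcup.

End measurable_option.

(* The restriction of a set function to the measurable sets: two measures have
   the same law iff they agree on every measurable set. (Two measures of the
   library can also differ on non-measurable sets, so that a functional of the
   measures themselves would be less constrained than a functional of laws.) *)
Definition law (R : realType) d (S : measurableType d) : Type :=
  {A : set S | measurable A} -> \bar R.

Definition law_of (R : realType) d (S : measurableType d)
    (m : set S -> \bar R) : law R S :=
  fun A => m (sval A).

Section missing_data.
Context (R : realType) (I : finType) (d : I -> measure_display)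
  (T : forall i, measurableType (d i)).

Definition values := prod_space T.
Definition proxies := prod_space (fun i : I => option (T i) : measurableType _).
Definition pattern := prod_space (fun _ : I => bool : measurableType _).

HB.instance Definition _ := Measurable.on values.
HB.instance Definition _ := Measurable.on proxies.
HB.instance Definition _ := Measurable.on pattern.

Definition joint_law := probability (values * proxies * pattern)%type R.

Definition proxy (x : values) (r : pattern) : proxies :=
  fun i => if r i then Some (x i) else None.

Definition XR (P : joint_law) : set (values * pattern) -> \bar R :=
  pushforward P (fun w => (w.1.1, w.2)).

Definition XstarR (P : joint_law) : set (proxies * pattern) -> \bar R :=
  pushforward P (fun w => (w.1.2, w.2)).

Definition full_law (P : joint_law) : law R (values * pattern)%type :=
  law_of (XR P).

Definition observed_data_law (P : joint_law) : law R (proxies * pattern)%type :=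
  law_of (XstarR P).

(* [p(X*,X,R) = p(X*|X,R) p(X,R)], the first factor being the point mass at
   [proxy x r]. *)
Definition proxies_deterministic (P : joint_law) : Prop :=
  forall A, measurable A ->
    P A = pushforward (XR P) (fun z => (z.1, proxy z.1 z.2, z.2)) A.

(* The model [M_Omega]; a description [Omega] is an arbitrary restriction on the
   joint law. *)
Definition missing_data_model (Omega : set joint_law) : set joint_law :=
  [set P | proxies_deterministic P /\ Omega P].

Definition identifiable (M : set joint_law) (Q : Type) (q : joint_law -> Q) :
    Prop :=
  exists f : law R (proxies * pattern)%type -> Q,
    forall P, M P -> q P = f (observed_data_law P).

Definition subvalues (D : pred I) :=
  prod_space (fun i : {i : I | D i} => T (sval i)).

HB.instance Definition _ (D : pred I) := Measurable.on (subvalues D).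

Definition observed (r : pattern) : pred I := fun i => r i.
Definition missing (r : pattern) : pred I := fun i => ~~ r i.

Definition merge (r : pattern) (x1 : subvalues (observed r))
    (x0 : subvalues (missing r)) : values :=
  fun i => match boolP (r i) with
           | AltTrue ri => x1 (exist _ i ri)
           | AltFalse nri => x0 (exist _ i nri)
           end.

Definition imputation_method : Type :=
  law R (proxies * pattern)%type ->
  forall r : pattern, R.-pker subvalues (observed r) ~> subvalues (missing r).

(* Reference measures for the probability mass/density functions: for instance
   counting for a discrete variable and Lebesgue for a continuous one. *)
Context (mu : forall i, {sigma_finite_measure set (T i) -> \bar R}).

Definition submeasure (D : pred I) : {measure set (subvalues D) -> \bar R} :=
  prod_measure (fun i : {i : I | D i} => mu (sval i)).

Definition is_full_density (P : joint_law) (p : values -> pattern -> R) :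
    Prop :=
  [/\ forall r, measurable_fun setT (p ^~ r),
      forall x r, 0 <= p x r &
      forall A r, measurable A ->
        (XR P (A `*` [set r]) = \int[prod_measure mu]_(x in A) (p x r)%:E)%E].

Definition positivity (P : joint_law) : Prop :=
  exists2 p, is_full_density P p & forall x r, 0 < p x r.

(* [p(x1, R = r)] *)
Definition observed_density (p : values -> pattern -> R) (r : pattern)
    (x1 : subvalues (observed r)) : R :=
  \int[submeasure (missing r)]_x0 p (merge x1 x0) r.

(* [p(x0 | x1, R_X1 = 1, R_X0 = 0)]; the conditioning event is [R = r]. *)
Definition conditional_density (p : values -> pattern -> R) (r : pattern)
    (x1 : subvalues (observed r)) (x0 : subvalues (missing r)) : R :=
  p (merge x1 x0) r / observed_density p x1.

(* Equality of the conditional distributions [xi_r(. | x1)] and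
   [p(. | x1, R = r)]. As densities are only determined up to null sets, "for
   all [x1]" means for almost all [x1] with respect to the reference measure,
   which is all [x1] in the case of counting measures. *)
Definition conditionally_complete (M : set joint_law) (xi : imputation_method) :
    Prop :=
  forall P, M P -> forall p, is_full_density P p -> forall r : pattern,
    {ae submeasure (observed r), forall x1, forall B, measurable B ->
       (xi (observed_data_law P) r x1 B =
        \int[submeasure (missing r)]_(x0 in B)
          (conditional_density p x1 x0)%:E)%E}.

End missing_data.

(* Main.v *)
Require Import Defs.
From HB Require Import structures.
From mathcomp Require Import all_boot all_order all_algebra.
From mathcomp Require Import all_classical all_reals all_analysis.
From mathcomp Require Import measurable_realfun.

(** For a fixed pattern [r], an assignment [x] splits into its observed part
    [x1] and its missing part [x0], and the reference measure is the product
    of the reference measures of the two parts ([prod_measure_merge], since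
    both sides agree on boxes). By Tonelli, the slice [p(x, r)] of the full
    density therefore factorizes as
      [p(x1, x0, r) = p(x1, r) * p(x0 | x1, r)].

    The first factor is always a function of the observed data law: when
    [R = r], the proxies record exactly [x1], so that the law of
    [(X1, R = r)] can be read off [p(X*, R)] ([observed_marginal]). All that
    the observed data law may leave undetermined is the second factor, the
    conditional distribution which a conditionally complete imputation has to
    supply.

    If such a method exists, two members of the model with the same observed
    data law have almost everywhere the same first factor, and the same second
    factor because both equal the kernel of the method; hence they have the
    same slices ([marginal_conditional_inj]) and, as there are finitely many
    patterns, the same full law ([conditionally_complete_full_law]).

    Conversely, if the full law is identifiable, all the members with observed
    data law [o] have the same full law, so their conditional distributions
    agree almost everywhere ([full_law_conditional]). The method chooses one
    member for each [o] and normalizes the slices of its density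
    ([conditional_kernel]). By positivity the normalizing constant never
    vanishes, and it is infinite only on a null set. *)

Set Implicit Arguments.
Unset Strict Implicit.
Unset Printing Implicit Defensive.

Import Order.TTheory GRing.Theory Num.Theory.

Local Open Scope classical_set_scope.
Local Open Scope ring_scope.

(* [merge] would otherwise denote the merging of sorted sequences. *)
Local Notation merge := Defs.merge.

(** * Product spaces and product measures *)

Section prod_space.
Context (I : Type) (d : I -> measure_display)
  (T : forall i, measurableType (d i)).

Lemma measurable_coord (i : I) :
  measurable_fun setT (fun x : prod_space T => x i).
Proof.
by move=> _ B mB; rewrite setTI; apply: sub_sigma_algebra; exists i, B.
Qed.

(** The cylinders generate the product sigma-algebra, so measurability into a
    product space can be tested coordinatewise. *)
Lemma measurable_fun_prod_space d' (S : measurableType d')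
    (f : S -> prod_space T) :
  (forall i, measurable_fun setT (fun s => f s i)) -> measurable_fun setT f.
Proof.
move=> mf; have mE : @measurable _ (prod_space T) = <<s cylinders T >> by [].
apply: (measurability _ mE) => _ [_ [i [B [mB ->]]] <-].
exact: mf.
Qed.

End prod_space.

Section boxes.
Context (I : finType) (d : I -> measure_display)
  (T : forall i, measurableType (d i)).

Definition box (B : forall i, set (T i)) : set (prod_space T) :=
  [set x | forall i, B i (x i)].

Definition boxes : set (set (prod_space T)) :=
  [set C | exists B : forall i, set (T i),
     (forall i, measurable (B i)) /\ C = box B].

Lemma measurable_box (B : forall i, set (T i)) :
  (forall i, measurable (B i)) -> measurable (box B).
Proof.
move=> mB.
have -> : box B = \bigcap_(i in [set: I]) (fun x : prod_space T => x i) @^-1` B i.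
  by apply/seteqP; split=> [x Bx i _|x Bx i]; exact: Bx.
apply: fin_bigcap_measurable; first exact: finite_finset.
by move=> i _; rewrite -[X in measurable X]setTI; exact: measurable_coord.
Qed.

(** A cylinder is a box all of whose sides but one are full; conversely, a box
    is a finite intersection of cylinders. *)
Lemma boxes_generate : @measurable _ (prod_space T) = <<s boxes >>.
Proof.
apply/seteqP; split.
  apply: smallest_sub; first exact: smallest_sigma_algebra.
  move=> _ [i [B [mB ->]]]; apply: sub_sigma_algebra.
  (* [B] lives over [T i]: it is transported along [i = j]. *)
  exists (fun j => if pselect (i = j) is left e
                   then ecast k (set (T k)) e B else setT).
  split=> [j|]; first by case: pselect => // e; case: _ / e.
  apply/seteqP; split=> [x /= Bx j|x /(_ i)] /=.
    by case: pselect => // e; case: _ / e.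
  by case: pselect => // e; rewrite (Prop_irrelevance e erefl).
apply: smallest_sub; first exact: sigma_algebra_measurable.
by move=> _ [B [mB ->]]; exact: measurable_box.
Qed.

Lemma setI_closed_boxes : setI_closed boxes.
Proof.
move=> _ _ [A [mA ->]] [B [mB ->]]; exists (fun i => A i `&` B i); split.
  by move=> i; exact: measurableI.
by apply/seteqP; split=> x /= => [[Ax Bx] i|ABx];
  [split; [exact: Ax|exact: Bx]|split=> i; have [] := ABx i].
Qed.

End boxes.

Section prod_measure_sigma_finite.
Local Open Scope ereal_scope.
Context (R : realType) (I : finType) (d : I -> measure_display)
  (T : forall i, measurableType (d i))
  (mu : forall i, {sigma_finite_measure set (T i) -> \bar R}).

Lemma prod_measure_boxE (B : forall i, set (T i)) :
  (forall i, measurable (B i)) ->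
  prod_measure mu (box B) = \prod_(i : I) mu i (B i).
Proof. exact: prod_measure_box. Qed.

(** Boxes whose sides run through increasing exhaustions of the factors by sets
    of finite measure. They serve both for sigma-finiteness and for the
    uniqueness of a measure given on boxes. *)
Lemma box_exhaustion : exists F : (set (prod_space T))^nat,
  [/\ forall n, boxes (F n), \bigcup_n F n = setT &
      forall n, prod_measure mu (F n) < +oo].
Proof.
have /all_sig[F HF] : forall i, {F : (set (T i))^nat |
    [/\ [set: T i] = \bigcup_n F n, nondecreasing_seq F &
        forall n, measurable (F n) /\ mu i (F n) < +oo]}.
  by move=> i; apply: cid; apply/sigma_finiteP; exact: sigma_finiteT.
exists (fun n => box (fun i => F i n)); split.
- by move=> n; exists (fun i => F i n); split=> // i; have [_ _ /(_ n)[]] := HF i.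
- apply/seteqP; split=> // x _.
  have /all_sig[n Hn] : forall i, {n | F i n (x i)}.
    move=> i; apply: cid; have [H _ _] := HF i.
    have : [set: T i] (x i) by [].
    by rewrite H => -[n _ ?]; exists n.
  (* Monotonicity lets one index, the largest, work for all coordinates. *)
  exists (\max_i n i)%N => // i /=.
  have [_ ndF _] := HF i; have := Hn i; apply/subsetPset/ndF.
  exact: leq_bigmax.
- move=> n; rewrite prod_measure_boxE; last first.
    by move=> i; have [_ _ /(_ n)[]] := HF i.
  rewrite -ge0_fin_numE ?prode_ge0//.
  apply: prode_fin_num => i _; rewrite ge0_fin_numE//.
  by have [_ _ /(_ n)[]] := HF i.
Qed.

Lemma sigma_finite_prod_measure : sigma_finite setT (prod_measure mu).
Proof.
have [F [bF FT Foo]] := box_exhaustion; exists F => // n; split=> //.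
by have [B [mB ->]] := bF n; exact: measurable_box.
Qed.

HB.instance Definition _ := Measure_isSigmaFinite.Build _ _ _
  (prod_measure mu) sigma_finite_prod_measure.

(** The boxes are stable under intersection, generate the sigma-algebra, and
    contain an exhausting sequence of sets of finite measure, so Dynkin's
    uniqueness theorem applies. *)
Lemma prod_measure_unique (m : {measure set (prod_space T) -> \bar R}) :
  (forall B : forall i, set (T i), (forall i, measurable (B i)) ->
     m (box B) = \prod_i mu i (B i)) ->
  forall A, measurable A -> prod_measure mu A = m A.
Proof.
move=> mE A mA; have [F [bF FT Foo]] := box_exhaustion.
apply: (@g_sigma_algebra_measure_unique _ R (prod_space T) (@boxes I d T) _ F
  bF FT (prod_measure mu) m _ _ Foo).
- by move=> _ [B [mB ->]]; exact: measurable_box.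
- exact: setI_closed_boxes.
- by move=> _ [B [mB ->]]; rewrite mE//; exact: prod_measure_boxE.
- by rewrite -boxes_generate.
Qed.

End prod_measure_sigma_finite.

(** The measure structure on a push-forward depends on a measurability proof,
    which unification cannot find; here it is an explicit argument. *)
Definition image_measure d d' (S : measurableType d) (S' : measurableType d')
    (R : realType) (m : {measure set S -> \bar R}) (f : S -> S')
    (mf : measurable_fun setT f) : {measure set S' -> \bar R} :=
  measure_function_pushforward__canonical__measure_function_Measure m mf.

(** * Marginals and conditional distributions of a joint density *)

Section conditioning.
Local Open Scope ereal_scope.
Context d1 d2 (X : measurableType d1) (Y : measurableType d2) (R : realType)
  (m1 : {sigma_finite_measure set X -> \bar R})
  (m2 : {sigma_finite_measure set Y -> \bar R}).

(** Kept extended-real valued, since the integral of one section of an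
    integrable density may be infinite. *)
Definition marginal (f : X * Y -> R) (x : X) : \bar R :=
  \int[m2]_y (f (x, y))%:E.

(** Where the marginal is [0] or infinite, [fine] and the convention
    [t / 0 = 0] make this the zero measure. *)
Definition conditional (f : X * Y -> R) (x : X) (B : set Y) : \bar R :=
  \int[m2]_(y in B) (f (x, y) / fine (marginal f x))%:E.

Section one_density.
Variable f : X * Y -> R.
Hypotheses (mf : measurable_fun setT f) (f0 : forall z, (0 <= f z)%R).

Lemma marginal_ge0 x : 0 <= marginal f x.
Proof. by apply: integral_ge0 => y _; rewrite lee_fin. Qed.

Lemma measurable_marginal : measurable_fun setT (marginal f).
Proof.
apply: (@measurable_fun_fubini_tonelli_F _ _ _ _ _ m2 (EFin \o f)).
  exact/measurable_EFinP.
by move=> z; rewrite lee_fin.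
Qed.

Lemma measurable_section (B : set Y) x :
  measurable_fun B (fun y => (f (x, y))%:E).
Proof. by apply/measurable_funTS/measurable_EFinP; exact: measurableT_comp. Qed.

Lemma conditionalE x B : measurable B ->
  conditional f x B = \int[m2]_(y in B) (f (x, y))%:E *
    ((fine (marginal f x))^-1)%:E.
Proof.
move=> mB; rewrite -ge0_integralZr//.
- exact: measurable_section.
- by move=> y _; rewrite lee_fin.
- by rewrite lee_fin invr_ge0 fine_ge0// marginal_ge0.
Qed.

(** The multiplication rule. It survives a vanishing marginal, because then the
    section of [f] has integral [0] over every set. *)
Lemma conditionalK x B : measurable B -> marginal f x \is a fin_num ->
  conditional f x B * marginal f x = \int[m2]_(y in B) (f (x, y))%:E.
Proof.
move=> mB fin; rewrite conditionalE//.
have [m0|m0] := eqVneq (marginal f x) 0.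
  rewrite m0 mule0; apply/esym/eqP; rewrite eq_le; apply/andP; split.
    rewrite -m0; apply: ge0_subset_integral => //; first exact: measurable_section.
    by move=> y _; rewrite lee_fin.
  by apply: integral_ge0 => y _; rewrite lee_fin.
rewrite -[X in _ * _ * X](fineK fin) -muleA -EFinM mulVf ?mule1//.
by rewrite fine_eq0.
Qed.

(** The integral over the sections of a region is that of the restriction of
    [f] to the region, to which Tonelli's theorem applies. *)
Lemma integral_xsectionE (A : set (X * Y)) :
  (fun x => \int[m2]_(y in xsection A x) (f (x, y))%:E) =
  fubini_F m2 ((EFin \o f) \_ A).
Proof.
apply/funext => x; rewrite /fubini_F [LHS]integral_mkcond.
by apply: eq_integral => y _; rewrite !patchE mem_xsection.
Qed.

Let measurable_patch (A : set (X * Y)) : measurable A ->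
  measurable_fun setT ((EFin \o f) \_ A).
Proof.
move=> mA; apply/(measurable_restrictT _ _).1 => //.
by apply: measurable_funTS; exact/measurable_EFinP.
Qed.

Let patch_ge0 (A : set (X * Y)) z : 0 <= ((EFin \o f) \_ A) z.
Proof. by rewrite patchE; case: ifP => // _; rewrite lee_fin. Qed.

Lemma measurable_integral_section (A : set (X * Y)) : measurable A ->
  measurable_fun setT (fun x => \int[m2]_(y in xsection A x) (f (x, y))%:E).
Proof.
move=> mA; rewrite integral_xsectionE.
by apply: measurable_fun_fubini_tonelli_F; [exact: measurable_patch|].
Qed.

Lemma integral_section (A : set (X * Y)) : measurable A ->
  \int[m1 \x m2]_(z in A) (f z)%:E =
  \int[m1]_x \int[m2]_(y in xsection A x) (f (x, y))%:E.
Proof.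
move=> mA; rewrite integral_xsectionE integral_mkcond.
by apply: fubini_tonelli1; [exact: measurable_patch|].
Qed.

Lemma integral_marginal (B : set X) : measurable B ->
  \int[m1 \x m2]_(z in B `*` setT) (f z)%:E = \int[m1]_(x in B) marginal f x.
Proof.
move=> mB; rewrite integral_section; last exact: measurableX.
rewrite [RHS]integral_mkcond; apply: eq_integral => x _.
rewrite patchE; case: ifPn => xB; first by rewrite in_xsectionX.
by rewrite notin_xsectionX// integral_set0.
Qed.

Hypothesis f_fin : \int[m1 \x m2]_z (f z)%:E < +oo.

Lemma integrable_marginal : m1.-integrable setT (marginal f).
Proof.
apply/integrableP; split; first exact: measurable_marginal.
under eq_integral do rewrite gee0_abs ?marginal_ge0//.
by rewrite -integral_marginal// setXTT.
Qed.

Lemma ae_marginal_fin_num : {ae m1, forall x, marginal f x \is a fin_num}.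
Proof.
by have := integrable_ae measurableT integrable_marginal; apply: filterS => x; exact.
Qed.

End one_density.

(** A density is determined by its marginal and its conditional distributions:
    by the multiplication rule they give the integral over almost every
    section of the region of integration. *)
Lemma marginal_conditional_inj (f g : X * Y -> R) :
  measurable_fun setT f -> measurable_fun setT g ->
  (forall z, 0 <= f z)%R -> (forall z, 0 <= g z)%R ->
  \int[m1 \x m2]_z (f z)%:E < +oo ->
  {ae m1, forall x, marginal f x = marginal g x} ->
  {ae m1, forall x, forall B, measurable B ->
     conditional f x B = conditional g x B} ->
  forall A, measurable A ->
  \int[m1 \x m2]_(z in A) (f z)%:E = \int[m1 \x m2]_(z in A) (g z)%:E.
Proof.
move=> mf mg f0 g0 f_fin eqm eqc A mA; rewrite !integral_section//.
apply: ge0_ae_eq_integral => //.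
- exact: measurable_integral_section.
- exact: measurable_integral_section.
- by move=> x _; apply: integral_ge0 => y _; rewrite lee_fin.
- by move=> x _; apply: integral_ge0 => y _; rewrite lee_fin.
have := ae_marginal_fin_num mf f0 f_fin.
apply: filterS3 eqm eqc => x eqm eqc fin _.
have mAx : measurable (xsection A x) by exact: measurable_xsection.
by rewrite -conditionalK// eqc// eqm conditionalK// -eqm.
Qed.

(** The measure of a null set is the integral of the measures of its sections,
    which therefore vanish almost everywhere. *)
Lemma ae_section (P : X * Y -> Prop) :
  {ae m1 \x m2, forall z, P z} -> {ae m1, forall x, {ae m2, forall y, P (x, y)}}.
Proof.
move=> [N [mN N0 PN]].
have mNx : measurable_fun setT (fun x => m2 (xsection N x)).
  exact: measurable_fun_xsection.
have : ae_eq m1 setT (fun x => m2 (xsection N x)) (cst 0).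
  apply/ae_eq_integral_abs => //; rewrite -[RHS]N0 /product_measure1.
  by apply: eq_integral => x _; rewrite gee0_abs.
apply: filterS => x /(_ Logic.I) Nx0; exists (xsection N x); split=> //.
  exact: measurable_xsection.
by move=> y Py; apply/xsectionP/PN.
Qed.

(** Densities with the same integrals agree almost everywhere, and then so do
    almost all their sections; the exceptional set of [x] does not depend on
    the event [B]. *)
Lemma ae_eq_conditional (f g : X * Y -> R) :
  measurable_fun setT f -> measurable_fun setT g ->
  (forall z, 0 <= f z)%R -> (forall z, 0 <= g z)%R ->
  \int[m1 \x m2]_z (f z)%:E < +oo ->
  (forall A, measurable A ->
    \int[m1 \x m2]_(z in A) (f z)%:E = \int[m1 \x m2]_(z in A) (g z)%:E) ->
  {ae m1, forall x, forall B, measurable B ->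
     conditional f x B = conditional g x B}.
Proof.
move=> mf mg f0 g0 f_fin fg.
have : ae_eq (m1 \x m2) setT (EFin \o f) (EFin \o g).
  apply: integral_ae_eq => //.
  - apply/integrableP; split; first exact/measurable_EFinP.
    by under eq_integral do rewrite gee0_abs ?lee_fin//.
  - exact/measurable_EFinP.
  - by move=> A _; exact: fg.
move=> /ae_section; apply: filterS => x fgx B mB.
have eqm : marginal f x = marginal g x.
  apply: ge0_ae_eq_integral => //; try exact: measurable_section.
    by move=> y _; rewrite lee_fin.
  by move=> y _; rewrite lee_fin.
rewrite !conditionalE// eqm; congr (_ * _).
apply: ge0_ae_eq_integral => //; try exact: measurable_section.
- by move=> y _; rewrite lee_fin.
- by move=> y _; rewrite lee_fin.
- by apply: filterS fgx => y /(_ Logic.I).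
Qed.

(** A kernel has to consist of probability measures at every point, so the
    sections which cannot be normalized get an arbitrary point mass. *)
Lemma conditional_kernel (f : X * Y -> R) :
  measurable_fun setT f -> (forall z, 0 <= f z)%R ->
  exists k : R.-pker X ~> Y, forall x, marginal f x != 0 ->
    marginal f x != +oo -> forall B, measurable B -> k x B = conditional f x B.
Proof.
move=> mf f0.
pose h x B := \int[m2]_(y in B) (f (x, y))%:E.
have h0 x : h x set0 = 0 by exact: integral_set0.
have h_ge0 x B : 0 <= h x B by apply: integral_ge0 => y _; rewrite lee_fin.
have h_add x : semi_sigma_additive (h x).
  apply: semi_sigma_additive_nng_induced; first exact: measurable_section.
  by move=> y; rewrite lee_fin.
pose hm x : {measure set Y -> \bar R} :=
  HB.pack (h x) (isMeasure.Build _ _ _ (h x) (h0 x) (h_ge0 x) (h_add x)).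
have mh B : measurable B -> measurable_fun setT (hm ^~ B).
  move=> mB; have := measurable_integral_section mf f0 (measurableX measurableT mB).
  congr (measurable_fun _ _); apply/funext => x; rewrite /hm /= /h.
  by rewrite in_xsectionX// in_setT.
pose k : R.-ker X ~> Y := HB.pack hm (isKernel.Build _ _ _ _ _ hm mh).
exists (knormalize k \d_point) => x x0 xoo B mB.
rewrite conditionalE// -[LHS]/(mnormalize (hm x) \d_point B).
rewrite /mnormalize ifF//.
by rewrite -[hm x setT]/(marginal f x) (negbTE x0) (negbTE xoo).
Qed.

End conditioning.

(** * Splitting assignments into observed and missing coordinates *)

Definition coords (I : finType) (d : I -> measure_display)
    (T : forall i, measurableType (d i)) (D : pred I) (x : values T) :
    subvalues T D := fun i => x (sval i).
Arguments coords {I d T} D x.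

Section merging.
Context (R : realType) (I : finType) (d : I -> measure_display)
  (T : forall i, measurableType (d i))
  (mu : forall i, {sigma_finite_measure set (T i) -> \bar R}).
Implicit Types (r : pattern I).

Lemma measurable_coords (D : pred I) : measurable_fun setT (@coords I d T D).
Proof. by apply: measurable_fun_prod_space => i; exact: measurable_coord. Qed.

Definition merge_pair r (z : subvalues T (observed r) * subvalues T (missing r)) :
  values T := merge z.1 z.2.

(** [merge] is a dependent match on [boolP (r i)]. Generalizing the boolean index
    of that proof, and nothing else, is what makes the case analysis
    well-typed. *)
Lemma merge_observed r (x1 : subvalues T (observed r))
    (x0 : subvalues T (missing r)) i (ri : observed r i) :
  merge x1 x0 i = x1 (exist _ i ri).
Proof.
have E b (e : alt_spec (r i) (r i) b) : b ->
    match e with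
    | AltTrue ri' => x1 (exist _ i ri')
    | AltFalse nri => x0 (exist _ i nri)
    end = x1 (exist _ i ri).
  by case: e => // ri' _; rewrite (bool_irrelevance ri ri').
exact: E (boolP (r i)) ri.
Qed.

Lemma merge_missing r (x1 : subvalues T (observed r))
    (x0 : subvalues T (missing r)) i (nri : missing r i) :
  merge x1 x0 i = x0 (exist _ i nri).
Proof.
have E b (e : alt_spec (r i) (r i) b) : ~~ b ->
    match e with
    | AltTrue ri => x1 (exist _ i ri)
    | AltFalse nri' => x0 (exist _ i nri')
    end = x0 (exist _ i nri).
  by case: e => // nri' _; rewrite (bool_irrelevance nri nri').
exact: E (boolP (r i)) nri.
Qed.

Lemma coords_merge_observed r (x1 : subvalues T (observed r))
    (x0 : subvalues T (missing r)) :
  coords (observed r) (merge x1 x0) = x1.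
Proof.
by apply/functional_extensionality_dep => -[i ri]; exact: merge_observed.
Qed.

Lemma coords_merge_missing r (x1 : subvalues T (observed r))
    (x0 : subvalues T (missing r)) :
  coords (missing r) (merge x1 x0) = x0.
Proof.
by apply/functional_extensionality_dep => -[i ri]; exact: merge_missing.
Qed.

Lemma measurable_merge r : measurable_fun setT (@merge_pair r).
Proof.
apply: measurable_fun_prod_space => i; case: (boolP (r i)) => ri.
- rewrite (_ : (fun z => _) = fun z => z.1 (exist _ i ri)); last first.
    by apply/funext => z; exact: merge_observed.
  have mi := @measurable_coord _ _ (fun j : {i | observed r i} => T (sval j))
    (exist _ i ri).
  exact: (measurableT_comp mi measurable_fst).
- rewrite (_ : (fun z => _) = fun z => z.2 (exist _ i ri)); last first.
    by apply/funext => z; exact: merge_missing.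
  have mi := @measurable_coord _ _ (fun j : {i | missing r i} => T (sval j))
    (exist _ i ri).
  exact: (measurableT_comp mi measurable_snd).
Qed.

(** The same measure as [submeasure], with its sigma-finiteness, which Tonelli's
    theorem requires. *)
Definition reference (D : pred I) :
    {sigma_finite_measure set (subvalues T D) -> \bar R} :=
  prod_measure (fun i : {i | D i} => mu (sval i)).

Lemma prode_sig (D : pred I) (F : I -> \bar R) :
  (\prod_(i | D i) F i = \prod_(i : {i | D i}) F (sval i))%E.
Proof. exact: (@big_sub _ _ _ I D F). Qed.

(** The inverse image of a box under merging is the product of the box of its
    observed sides and the box of its missing sides. *)
Lemma prod_measure_merge r (A : set (values T)) : measurable A ->
  prod_measure mu A =
  ((reference (observed r) \x reference (missing r)) (@merge_pair r @^-1` A))%E.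
Proof.
apply: (prod_measure_unique (m := image_measure
  (reference (observed r) \x reference (missing r))%E
  (@measurable_merge r))) => B mB.
rewrite /= /pushforward.
have -> : @merge_pair r @^-1` box B =
    box (fun i : {i | observed r i} => B (sval i)) `*`
    box (fun i : {i | missing r i} => B (sval i)).
  apply/seteqP; split=> [[x1 x0] /= Bx|[x1 x0] /= [Bx1 Bx0] i].
    split=> -[i ri] /=; have := Bx i; rewrite /merge_pair.
      by rewrite merge_observed.
    by rewrite merge_missing.
  rewrite /merge_pair; case: (boolP (r i)) => ri.
    by rewrite (merge_observed _ _ ri); exact: (Bx1 (exist _ i ri)).
  by rewrite (merge_missing _ _ ri); exact: (Bx0 (exist _ i ri)).
rewrite product_measure1E; last 2 first.
- by apply: measurable_box => i; exact: mB.
- by apply: measurable_box => i; exact: mB.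
rewrite /= !prod_measure_boxE; [|by move=> i; exact: mB..].
rewrite (bigID (observed r)) /=.
by congr (_ * _)%E; [rewrite -(prode_sig (observed r) (fun i => mu i (B i)))|
  rewrite -(prode_sig (missing r) (fun i => mu i (B i)))].
Qed.

Lemma integral_merge r (f : values T -> \bar R) (A : set (values T)) :
  measurable A -> measurable_fun setT f -> (forall x, 0 <= f x)%E ->
  (\int[prod_measure mu]_(x in A) f x =
   \int[reference (observed r) \x reference (missing r)]_(z in @merge_pair r @^-1` A)
     f (merge_pair z))%E.
Proof.
move=> mA mf f0; have mm := @measurable_merge r.
rewrite -(ge0_integral_pushforward mm
  (reference (observed r) \x reference (missing r))%E mA)//; last first.
  exact: measurable_funTS.
apply: (eq_measure_integral (image_measure _ mm)) => B mB _.
exact: prod_measure_merge.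
Qed.

End merging.

(** * The full law and the observed data law *)

Section patterns.
Context (I : finType).

Lemma measurable_pattern1 (r : pattern I) : measurable [set r].
Proof.
have -> : [set r] = box (fun i : I => [set r i]) :> set (pattern I).
  apply/seteqP; split=> [_ -> //|s rs].
  by apply/functional_extensionality_dep => i; exact: rs.
exact: measurable_box.
Qed.

Lemma finite_patterns : finite_set [set: pattern I].
Proof.
have -> : [set: pattern I] = (fun f : {ffun I -> bool} => f : pattern I) @` setT.
  apply/seteqP; split=> // r _; exists [ffun i => r i] => //.
  by apply/functional_extensionality_dep => i; rewrite ffunE.
by apply: finite_image; exact: finite_finset.
Qed.

(** As there are finitely many patterns, every event is a finite disjoint union
    of slices [A `*` [set r]]. *)
Lemma eq_measure_pattern (R : realType) d (S : measurableType d)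
    (m m' : {measure set (S * pattern I) -> \bar R}) :
  (forall A r, measurable A -> m (A `*` [set r]) = m' (A `*` [set r])) ->
  forall A, measurable A -> m A = m' A.
Proof.
move=> mm' A mA; pose F r := ysection A r `*` [set r].
have mAr r : measurable (ysection A r) by exact: measurable_ysection.
have mF r : measurable (F r).
  by apply: measurableX => //; exact: measurable_pattern1.
have tF : trivIset setT F.
  by apply/trivIsetP => r s _ _ rs; apply/seteqP; split=> // -[x t] /=
    [[_ /= tr] [_ /= ts]]; rewrite -tr -ts eqxx in rs.
have -> : A = \bigcup_(r in setT) F r.
  apply/seteqP; split=> [[x r] Axr|[x r] [s _ [/= /ysectionP Axs ->]]] //.
  by exists r => //; split=> //; apply/ysectionP.
by rewrite !measure_fin_bigcup//; [apply: eq_fsbigr => r _; exact: mm'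
  |exact: finite_patterns|exact: finite_patterns].
Qed.

End patterns.

Section full_and_observed_laws.
Local Open Scope ereal_scope.
Context (R : realType) (I : finType) (d : I -> measure_display)
  (T : forall i, measurableType (d i))
  (mu : forall i, {sigma_finite_measure set (T i) -> \bar R}).
Implicit Types (P : joint_law R T) (r : pattern I) (p : values T -> pattern I -> R).

Definition split_density p r
    (z : subvalues T (observed r) * subvalues T (missing r)) : R :=
  p (merge_pair z) r.

Local Notation obs r := (reference mu (observed r)).
Local Notation mis r := (reference mu (missing r)).

(** Merging is an isomorphism of measurable spaces: no event about the pair
    [(x1, x0)] is lost by looking at the merged assignment only. *)
Lemma merge_pair_preimage r (A : set (subvalues T (observed r) * subvalues T (missing r))) :
  measurable A -> exists2 A', measurable A' & A = @merge_pair I d T r @^-1` A'.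
Proof.
move=> mA; pose unmerge (x : values T) := (coords (observed r) x, coords (missing r) x).
have munmerge : measurable_fun setT unmerge.
  by apply: measurable_fun_pair; exact: measurable_coords.
exists (unmerge @^-1` A); first by rewrite -[X in measurable X]setTI; exact: munmerge.
apply/seteqP; split=> -[x1 x0] /=;
  by rewrite /unmerge /merge_pair coords_merge_observed coords_merge_missing.
Qed.

Lemma measurable_XR : measurable_fun setT
  (fun w : values T * proxies T * pattern I => (w.1.1, w.2)).
Proof.
apply: measurable_fun_pair; last exact: measurable_snd.
exact: (measurableT_comp measurable_fst measurable_fst).
Qed.

Lemma measurable_XstarR : measurable_fun setT
  (fun w : values T * proxies T * pattern I => (w.1.2, w.2)).
Proof.
apply: measurable_fun_pair; last exact: measurable_snd.
exact: (measurableT_comp measurable_snd measurable_fst).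
Qed.

Lemma eq_full_law P P' :
  (forall A r, measurable A -> XR P (A `*` [set r]) = XR P' (A `*` [set r])) ->
  full_law P = full_law P'.
Proof.
move=> e; apply/funext => -[A mA]; rewrite /full_law /law_of /=.
exact: (eq_measure_pattern (m := image_measure P measurable_XR)
  (m' := image_measure P' measurable_XR)).
Qed.

(** On the event [R = r] the default value is never used. *)
Definition recorded r (s : proxies T) : subvalues T (observed r) :=
  fun i => odflt point (s (sval i)).

Lemma measurable_recorded r : measurable_fun setT (@recorded r).
Proof.
apply: measurable_fun_prod_space => i.
have mo : measurable_fun setT (odflt point : option (T (sval i)) -> T (sval i)).
  by move=> _ B mB; rewrite setTI.
exact: (measurableT_comp mo (@measurable_coord I _ (fun i => option (T i)) _)).
Qed.

Lemma recorded_proxy r (x : values T) :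
  recorded (r := r) (proxy x r) = coords (observed r) x.
Proof.
apply/functional_extensionality_dep => -[i ri].
by rewrite /recorded /proxy /coords /= ifT.
Qed.

Section one_law.
Variables (P : joint_law R T) (p : values T -> pattern I -> R).
Hypothesis dp : is_full_density mu P p.

Lemma measurable_split_density r : measurable_fun setT (split_density p (r := r)).
Proof. by have [mp _ _] := dp; exact: (measurableT_comp (mp r) (@measurable_merge _ _ _ r)). Qed.

Lemma split_density_ge0 r z : (0 <= split_density p (r := r) z)%R.
Proof. by have [_ p0 _] := dp; exact: p0. Qed.

Lemma XR_split r A : measurable A ->
  XR P (A `*` [set r]) =
  \int[obs r \x mis r]_(z in @merge_pair I d T r @^-1` A) (split_density p z)%:E.
Proof.
move=> mA; have [mp p0 pE] := dp; rewrite pE// (integral_merge mu r)//.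
  by apply/measurable_EFinP; exact: mp.
by move=> x; rewrite lee_fin.
Qed.

Lemma split_density_lty r : \int[obs r \x mis r]_z (split_density p z)%:E < +oo.
Proof.
have := XR_split r measurableT; rewrite preimage_setT => <-.
apply: (@le_lt_trans _ _ 1); last exact: ltry.
apply: probability_le1; rewrite -[X in measurable X]setTI; apply: measurable_XR => //.
by apply: measurableX => //; exact: measurable_pattern1.
Qed.

(** The proxies are a function of [(X, R)], and those of an assignment [x] with
    pattern [r] record exactly the observed coordinates of [x]. Hence the
    marginal density of the observed coordinates under the pattern [r] is a
    functional of the observed data law. *)
Lemma observed_marginal r B : proxies_deterministic P -> measurable B ->
  XstarR P (@recorded r @^-1` B `*` [set r]) =
  \int[obs r]_(x1 in B) marginal (mis r) (@split_density p r) x1.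
Proof.
move=> dP mB; rewrite -integral_marginal//; last 2 first.
- exact: measurable_split_density.
- exact: split_density_ge0.
have mD : measurable (@recorded r @^-1` B).
  by rewrite -[X in measurable X]setTI; exact: measurable_recorded.
rewrite /XstarR /pushforward dP; last first.
  rewrite -[X in measurable X]setTI; apply: measurable_XstarR => //.
  by apply: measurableX => //; exact: measurable_pattern1.
have -> : B `*` setT = @merge_pair I d T r @^-1` (coords (observed r) @^-1` B).
  by apply/seteqP; split=> -[x1 x0] /=; rewrite /merge_pair coords_merge_observed => // -[].
rewrite -XR_split; last first.
  by rewrite -[X in measurable X]setTI; exact: measurable_coords.
rewrite /pushforward; congr (XR P _); apply/seteqP.
by split=> -[x s] /= [+ sr]; rewrite sr recorded_proxy.
Qed.

End one_law.

(** If the missing coordinates had a null reference measure, the whole product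
    measure would vanish, and no law with a density would have total mass
    [1]. *)
Lemma reference_missing_neq0 P p r :
  is_full_density mu P p -> mis r [set: subvalues T (missing r)] != 0.
Proof.
move=> dp; apply/eqP => mis0.
have mu0 : prod_measure mu [set: prod_space T] = 0.
  rewrite (prod_measure_merge mu r)// preimage_setT -setXTT product_measure1E//.
  by rewrite mis0 mule0.
suff : XR P setT = 0.
  by rewrite /XR /pushforward preimage_setT probability_setT => /eqP; rewrite onee_eq0.
have [mp p0 pE] := dp.
apply: (eq_measure_pattern (m := image_measure P measurable_XR) (m' := mzero)) => //.
move=> A s mA; rewrite -[LHS]/(XR P (A `*` [set s])) pE//.
apply: null_set_integral => //.
  by apply/measurable_funTS/measurable_EFinP; exact: mp.
exact: subset_measure0 mu0.
Qed.

(** A positive function has integral [0] only with respect to the zero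
    measure. *)
Lemma marginal_neq0 P p r x1 : is_full_density mu P p ->
  (forall x s, 0 < p x s)%R -> marginal (mis r) (@split_density p r) x1 != 0.
Proof.
move=> dp p0; apply: contraNneq (reference_missing_neq0 r dp) => marg0.
have mf : measurable_fun setT (fun x0 => (@split_density p r (x1, x0))%:E).
  exact: (measurable_section (@measurable_split_density _ _ dp r)).
have /ae_eq_integral_abs : \int[mis r]_x0 `|(split_density p (x1, x0))%:E| = 0.
  rewrite -[RHS]marg0; apply: eq_integral => x0 _.
  by rewrite gee0_abs// lee_fin (split_density_ge0 dp).
move=> /(_ measurableT mf) h; apply/eqP/negligibleP => //.
apply: negligibleS h => x0 _ /= /(_ Logic.I) [].
by apply/eqP; rewrite gt_eqF// p0.
Qed.

Lemma eq_observed_marginal P P' p p' r :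
  proxies_deterministic P -> proxies_deterministic P' ->
  is_full_density mu P p -> is_full_density mu P' p' ->
  observed_data_law P = observed_data_law P' ->
  {ae obs r, forall x1, marginal (mis r) (@split_density p r) x1 =
                        marginal (mis r) (@split_density p' r) x1}.
Proof.
move=> dP dP' dp dp' eqo.
have ms := measurable_split_density dp (r := r).
have ms' := measurable_split_density dp' (r := r).
have s0 := split_density_ge0 dp (r := r).
have s0' := split_density_ge0 dp' (r := r).
have : ae_eq (obs r) setT (marginal (mis r) (@split_density p r))
    (marginal (mis r) (@split_density p' r)).
  apply: integral_ae_eq => //.
  - exact: integrable_marginal ms s0 (split_density_lty dp r).
  - exact: measurable_marginal ms' s0'.
  - move=> B _ mB; rewrite -(observed_marginal dp)// -(observed_marginal dp')//.
    have mC : measurable (@recorded r @^-1` B `*` [set r]).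
      apply: measurableX; last exact: measurable_pattern1.
      by rewrite -[X in measurable X]setTI; exact: measurable_recorded.
    exact: (congr1 (fun l => l (exist _ _ mC)) eqo).
by apply: filterS => x1; exact.
Qed.

(** * Imputation methods and identification *)

(** Both factors of each slice are functions of the observed data law: the
    marginal always is, and the conditional distribution is given by the
    imputation method. *)
Lemma conditionally_complete_full_law (M : set (joint_law R T))
    (xi : imputation_method R T) P P' :
  (forall P, M P -> proxies_deterministic P /\ positivity mu P) ->
  conditionally_complete mu M xi -> M P -> M P' ->
  observed_data_law P = observed_data_law P' -> full_law P = full_law P'.
Proof.
move=> HM cc MP MP' eqo.
have [dP [p dp _]] := HM _ MP; have [dP' [p' dp' _]] := HM _ MP'.
apply: eq_full_law => A r mA; rewrite (XR_split dp)// (XR_split dp')//.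
apply: (marginal_conditional_inj (f := @split_density p r)
  (g := @split_density p' r)).
- exact: (@measurable_split_density _ _ dp r).
- exact: (@measurable_split_density _ _ dp' r).
- exact: (@split_density_ge0 _ _ dp r).
- exact: (@split_density_ge0 _ _ dp' r).
- exact: split_density_lty dp r.
- exact: (eq_observed_marginal r dP dP' dp dp' eqo).
- have H := cc _ MP _ dp r; have := cc _ MP' _ dp' r; rewrite -eqo.
  apply: filterS2 H => x1 H H' B mB; have := H B mB; rewrite H'//.
- by rewrite -[X in measurable X]setTI; exact: measurable_merge.
Qed.

Lemma full_law_conditional (P P' : joint_law R T) p p' r :
  is_full_density mu P p -> is_full_density mu P' p' ->
  full_law P = full_law P' ->
  {ae obs r, forall x1, forall B, measurable B ->
     conditional (mis r) (@split_density p r) x1 B =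
     conditional (mis r) (@split_density p' r) x1 B}.
Proof.
move=> dp dp' eqf; apply: (ae_eq_conditional (f := @split_density p r)
  (g := @split_density p' r)).
- exact: (@measurable_split_density _ _ dp r).
- exact: (@measurable_split_density _ _ dp' r).
- exact: (@split_density_ge0 _ _ dp r).
- exact: (@split_density_ge0 _ _ dp' r).
- exact: split_density_lty dp r.
- move=> _ /merge_pair_preimage[A mA ->]; rewrite -(XR_split dp)// -(XR_split dp')//.
  have mC : measurable (A `*` [set r]).
    by apply: measurableX => //; exact: measurable_pattern1.
  exact: (congr1 (fun l => l (exist _ _ mC)) eqf).
Qed.

(** The kernel is built from the density of one member chosen for each observed
    data law; it suits the other members because they share its full law. *)
Lemma identifiable_imputation (M : set (joint_law R T)) :
  (forall P, M P -> positivity mu P) -> identifiable M (@full_law R I d T) ->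
  exists xi : imputation_method R T, conditionally_complete mu M xi.
Proof.
move=> HM [f fE].
have ker (o : law R (proxies T * pattern I)%type) r :
    {k : R.-pker subvalues T (observed r) ~> subvalues T (missing r) |
     forall P, M P -> observed_data_law P = o ->
     forall p, is_full_density mu P p ->
     {ae submeasure mu (observed r), forall x1, forall B, measurable B ->
       k x1 B = \int[submeasure mu (missing r)]_(x0 in B)
                 (conditional_density mu p x1 x0)%:E}}.
  apply: cid.
  have [[P0 MP0 oP0]|noP] := pselect (exists2 P, M P & observed_data_law P = o).
    (* The everywhere positive density is used: its marginals vanish nowhere,
       whereas those of another density may vanish on a null set. *)
    have [p0 dp0 p0_gt0] := HM _ MP0.
    have ms0 := measurable_split_density dp0 (r := r).
    have s0 := split_density_ge0 dp0 (r := r).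
    have [k kE] := conditional_kernel (mis r) ms0 s0.
    exists k => P MP oP p dp.
    have eqf : full_law P = full_law P0 by rewrite !fE// oP oP0.
    have fin := ae_marginal_fin_num ms0 s0 (split_density_lty dp0 r).
    have := full_law_conditional r dp dp0 eqf.
    apply: filterS2 fin => x1 fin eqc B mB.
    rewrite kE//; first by rewrite -eqc.
      exact: (marginal_neq0 x1 dp0 p0_gt0).
    by move: fin; rewrite fin_numE => /andP[].
  (* No member has the observed data law [o], so any kernel will do. *)
  exists (kprobability (measurable_cst (\d_point : pprobability _ _))) => P MP oP.
  by case: noP; exists P.
exists (fun o r => sval (ker o r)) => P MP p dp r.
exact: (svalP (ker (observed_data_law P) r) P MP erefl p dp).
Qed.

End full_and_observed_laws.

Theorem theorem2p4 (R : realType) (I : finType) (d : I -> measure_display)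
    (T : forall i : I, measurableType (d i))
    (mu : forall i : I, {sigma_finite_measure set (T i) -> \bar R})
    (Omega : set (joint_law R T))
    (hpos : forall P, missing_data_model Omega P -> positivity mu P) :
  (exists xi : imputation_method R T,
     conditionally_complete mu (missing_data_model Omega) xi) <->
  identifiable (missing_data_model Omega) (@full_law R I d T).
Proof.
split=> [[xi cc]|]; last exact: identifiable_imputation.
set M := missing_data_model Omega.
(* The functional sends an observed data law to the full law of any member
   which has it; the value does not depend on the member. *)
exists (fun o => if pselect (exists2 P, M P & observed_data_law P = o) is left e
                 then full_law (s2val (cid2 e)) else (fun=> 0%E)) => P MP.
case: pselect => [e|[]]; last by exists P.
case: (cid2 e) => /= P' MP' oP'.
apply: conditionally_complete_full_law cc MP MP' (esym oP').
by move=> P1 MP1; split; [case: MP1|exact: hpos].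
Qed.
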